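(* Let $G$ be a cocompact lattice in $SO(2,1)$, let $p>1$, and let $p'$ be the conjugate exponent, $\frac1p+\frac1{p'}=1$. Let $\mathcal{F}:G\to\mathbb{R}$ be a function such that $L_g\mathcal{F}-\mathcal{F}\in l^p(G)$ for all $g\in G$. Then for any word length on $G$ there is a constant $c$ (independent of $g$) such that $$|\mathcal{F}(g)|\le c\,[\mathrm{length}(g)]^{1/p'}\qquad\text{for all } g\in G,\ g\ne 1.$$
   Context: $L_g$ denotes the left action on functions on $G$: $(L_g\mathcal{F})(x)=\mathcal{F}(g^{-1}x)$. A word length on $G$ is the length function $\mathrm{length}(g)$ with respect to some finite generating set. *)

(* Defs.v *)
From HB Require Import structures.
From mathcomp Require Import all_boot all_order all_algebra.
From mathcomp Require Import all_classical all_reals all_analysis.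

Set Implicit Arguments.
Unset Strict Implicit.
Unset Printing Implicit Defensive.

Import Order.TTheory GRing.Theory Num.Theory.
Import numFieldNormedType.Exports.

Local Open Scope classical_set_scope.
Local Open Scope ring_scope.

(* The Gram matrix of x_0^2 + x_1^2 - x_2^2. *)
Definition form21 (R : realType) : 'M[R]_3 :=
  \matrix_(i, j) (if i != j then 0 else if i == ord_max then -1 else 1).

Definition is_SO21 (R : realType) (A : 'M[R]_3) : bool :=
  (A^T *m form21 R *m A == form21 R) && (\det A == 1).

Record SO21 (R : realType) := MkSO21 {
  SO21_mx : 'M[R]_3;
  SO21_mxP : is_SO21 SO21_mx }.

HB.instance Definition _ (R : realType) := [isSub for @SO21_mx R].
HB.instance Definition _ (R : realType) := [Choice of SO21 R by <:].

Section SO21_group.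
Variable R : realType.
Implicit Types A B : SO21 R.

Lemma is_SO21_unit (A : 'M[R]_3) : is_SO21 A -> A \in unitmx.
Proof. by move=> /andP[_ /eqP dA]; rewrite unitmxE dA unitr1. Qed.

Lemma is_SO21_1 : is_SO21 (1%:M : 'M[R]_3).
Proof. by rewrite /is_SO21 trmx1 mul1mx mulmx1 det1 !eqxx. Qed.

Lemma is_SO21_mul (A B : 'M[R]_3) :
  is_SO21 A -> is_SO21 B -> is_SO21 (A *m B).
Proof.
move=> /andP[/eqP fA /eqP dA] /andP[/eqP fB /eqP dB].
rewrite /is_SO21 trmx_mul det_mulmx dA dB mulr1 eqxx andbT.
by rewrite !mulmxA -(mulmxA B^T) -(mulmxA B^T) fA fB.
Qed.

Lemma is_SO21_inv (A : 'M[R]_3) : is_SO21 A -> is_SO21 (invmx A).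
Proof.
move=> sA; have uA := is_SO21_unit sA.
have /andP[/eqP fA /eqP dA] := sA.
rewrite /is_SO21 det_inv dA invr1 eqxx andbT -{1}fA trmx_inv.
by rewrite !mulmxA mulVmx ?unitmx_tr// mul1mx -mulmxA mulmxV// mulmx1.
Qed.

Definition SO21_one := MkSO21 is_SO21_1.
Definition SO21_mul A B := MkSO21 (is_SO21_mul (SO21_mxP A) (SO21_mxP B)).
Definition SO21_inv A := MkSO21 (is_SO21_inv (SO21_mxP A)).

Lemma SO21_mulA : associative SO21_mul.
Proof. by move=> A B C; apply/val_inj; rewrite /= mulmxA. Qed.

Lemma SO21_mul1 : left_id SO21_one SO21_mul.
Proof. by move=> A; apply/val_inj; rewrite /= mul1mx. Qed.

Lemma SO21_1mul : right_id SO21_one SO21_mul.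
Proof. by move=> A; apply/val_inj; rewrite /= mulmx1. Qed.

Lemma SO21_mulV : left_inverse SO21_one SO21_inv SO21_mul.
Proof.
by move=> A; apply/val_inj; rewrite /= mulVmx// is_SO21_unit// SO21_mxP.
Qed.

Lemma SO21_Vmul : right_inverse SO21_one SO21_inv SO21_mul.
Proof.
by move=> A; apply/val_inj; rewrite /= mulmxV// is_SO21_unit// SO21_mxP.
Qed.

HB.instance Definition _ := isGroup.Build (SO21 R)
  SO21_mulA SO21_mul1 SO21_1mul SO21_mulV SO21_Vmul.

End SO21_group.

HB.instance Definition _ (R : realType) :=
  Topological.copy (SO21 R) (initial_topology (@SO21_mx R)).

Section subgroup.
Variables (T : groupType) (G : groupClosed T).

Definition subgroup_type : Type := {x : T | x \in G}.

Lemma groupClosed_group_closed : group_closed G.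
Proof. by split; [exact: gpred1 | exact: gpredF]. Qed.

HB.instance Definition _ := SubChoice.on subgroup_type.
HB.instance Definition _ :=
  SubChoice_isSubGroup.Build T _ subgroup_type groupClosed_group_closed.

Definition coset_rel : rel T := [rel x y | (x^-1 * y)%g \in G].

Lemma coset_rel_refl : reflexive coset_rel.
Proof. by move=> x; rewrite /coset_rel /= mulVg gpred1. Qed.

Lemma coset_rel_sym : symmetric coset_rel.
Proof. by move=> x y; rewrite /coset_rel /= -gpredV invgM invgK. Qed.

Lemma coset_rel_trans : transitive coset_rel.
Proof.
rewrite /coset_rel => y x z /= xy yz.
by rewrite -(mulgK y x^-1)%g -mulgA gpredM.
Qed.

Canonical coset_equiv :=
  EquivRel coset_rel coset_rel_refl coset_rel_sym coset_rel_trans.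

(* The space T / G of cosets xG. *)
Definition coset_space : Type := {eq_quot coset_equiv}%qT.

End subgroup.

HB.instance Definition _ (T : groupType) (G : groupClosed T) :=
  EqQuotient.on (coset_space G).

Section lattice.
Variable R : realType.
Implicit Type G : groupClosed (SO21 R).

Definition discrete_subgroup G :=
  forall U : set (initial_topology (val : subgroup_type G -> SO21 R)), open U.

Definition cocompact_subgroup G :=
  compact [set: quotient_topology (coset_space G)].

(* Finite covolume is automatic: an invariant Radon measure on the compact
   space SO(2,1) / G is finite. *)
Definition cocompact_lattice G := discrete_subgroup G /\ cocompact_subgroup G.

End lattice.

Section functions_on_groups.
Variables (R : realType) (T : groupType).

Definition left_act (g : T) (f : T -> R) : T -> R :=
  fun x => f (g^-1 * x)%g.

Definition in_lp (p : R) (f : T -> R) : Prop :=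
  (\esum_(x in [set: T]) (`|f x| `^ p)%:E < +oo)%E.

End functions_on_groups.

Section word_length.
Variable T : groupType.
Implicit Types (S w : seq T) (g : T).

Definition word_in S w : bool :=
  all (fun s => (s \in S) || (s^-1%g \in S)) w.

Definition has_word_of_size S g (n : nat) : Prop :=
  exists w, [/\ word_in S w, size w = n & (\prod_(s <- w) s)%g = g].

Definition generates S : Prop := forall g, exists n, has_word_of_size S g n.

Lemma generates_asbool S g :
  generates S -> exists n, `[< has_word_of_size S g n >].
Proof. by move=> genS; have [n wn] := genS g; exists n; apply/asboolP. Qed.

Definition word_length S (genS : generates S) g : nat :=
  ex_minn (generates_asbool g genS).

End word_length.

(* Main.v *)
Require Import Defs.
From HB Require Import structures.
From mathcomp Require Import all_boot all_order all_algebra.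
From mathcomp Require Import all_classical all_reals all_analysis.
From mathcomp Require Import ring.

Import Order.TTheory GRing.Theory Num.Theory.
Import numFieldNormedType.Exports.

Local Open Scope classical_set_scope.
Local Open Scope ring_scope.

Set Implicit Arguments.
Unset Strict Implicit.

(** The bound is a form of Hoelder's inequality along a geodesic of the word
    metric.  Write a shortest word a_1 ... a_n for g and
    let x_k = a_(k+1) ... a_n be its suffixes, so that x_0 = g, x_n = 1 and
    x_k = a_(k+1) x_(k+1).  The increment F x_k - F x_(k+1) is the value at
    x_(k+1) of L_s F - F for s the inverse of a_(k+1), one of finitely many
    functions in l^p.  Suffixes of a shortest word are pairwise distinct
    ([suffix_prod_inj]), so the p-th powers of the n increments add up to at
    most a constant M depending only on p, F and the generators
    ([geodesic_increments]).  A sum of n nonnegative reals whose p-th powers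
    add up to at most M is at most n^(1/p') (1 + M) ([sum_le_powR]).  Finally
    F 1 is absorbed in the constant, since n >= 1 when g <> 1. *)

Section power_mean.
Variable R : realType.

(** Below the threshold [t] the first term suffices; above it,
    [d = d ^ p * d ^ (1 - p)] and the second factor decreases with [d]. *)
Lemma le_threshold_powR (t d p : R) : 0 < t -> 0 <= d -> 1 < p ->
  d <= t + d `^ p * t `^ (1 - p).
Proof.
move=> t0 d0 p1; have [dt|/ltW td] := leP d t.
  by rewrite (le_trans dt)// lerDl mulr_ge0 ?powR_ge0.
have tV : t `^ (p - 1) * t `^ (1 - p) = 1.
  by rewrite -powRD ?(gt_eqF t0) ?implybT// subrKA subrr powRr0.
rewrite -(mulr_powRB1 d0) ?(lt_trans _ p1)// -mulrA.
rewrite -[leLHS](mulr1 d) (@le_trans _ _ (d * (d `^ (p - 1) * t `^ (1 - p))))//.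
  rewrite ler_wpM2l// -{1}tV ler_wpM2r ?powR_ge0// ge0_ler_powR ?nnegrE//.
  - by rewrite subr_ge0 ltW.
  - exact: ltW.
by rewrite lerDr ltW.
Qed.

Lemma sum_le_powR (p p' : R) (d : nat -> R) (n : nat) :
  1 < p -> p^-1 + p'^-1 = 1 -> (0 < n)%N -> (forall k, 0 <= d k) ->
  \sum_(0 <= k < n) d k
    <= n%:R `^ p'^-1 * (1 + \sum_(0 <= k < n) d k `^ p).
Proof.
move=> p1 pp' n0 d0.
have nR : 0 < n%:R :> R by rewrite ltr0n.
have nR0 : n%:R != 0 :> R by rewrite gt_eqF.
(* This threshold makes n t, the total of the first terms in
   [le_threshold_powR], equal to the coefficient t^(1-p) of the second ones. *)
pose t : R := n%:R `^ (- p^-1).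
have t0 : 0 < t by exact: powR_gt0.
have nt : t *+ n = n%:R `^ p'^-1.
  rewrite -[LHS]mulr_natl -[X in X * _](powRr1 (ltW nR)) -powRD ?nR0 ?implybT//.
  by rewrite -pp' addrAC subrr add0r.
have tp : t `^ (1 - p) = n%:R `^ p'^-1.
  rewrite /t -powRrM; congr (_ `^ _).
  have -> : p'^-1 = 1 - p^-1 by rewrite -pp' addrAC subrr add0r.
  by rewrite mulrBr mulr1 mulNr mulVf ?gt_eqF// ?(lt_trans _ p1)//; ring.
rewrite mulrDr mulr1 -{1}nt -tp mulr_sumr.
rewrite -[X in t *+ X](subn0 n) -sumr_const_nat -big_split/=.
by apply: ler_sum => k _; rewrite [X in _ + X]mulrC le_threshold_powR.
Qed.

End power_mean.

Lemma in_lp_sum (R : realType) (T : groupType) (p : R) (f : T -> R)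
    (xs : seq T) : in_lp p f -> uniq xs ->
  \sum_(x <- xs) `|f x| `^ p
    <= fine (\esum_(x in [set: T]) (`|f x| `^ p)%:E).
Proof.
move=> fp uxs.
have e0 : (0 <= \esum_(x in [set: T]) (`|f x| `^ p)%:E)%E.
  by apply: esum_ge0 => x _; rewrite lee_fin powR_ge0.
rewrite -lee_fin fineK ?ge0_fin_numE// -sumEFin fsbig_seq//.
by apply: esum_ge; exists [set` xs] => //; split => //; exact: finite_seq.
Qed.

Section geodesic.
Variables (T : groupType) (S : seq T).
Implicit Types w : seq T.

Definition geodesic w : Prop := word_in S w /\
  forall w', word_in S w' -> (\prod_(s <- w') s = \prod_(s <- w) s)%g ->
    (size w <= size w')%N.

Definition suffix_prod w k : T := (\prod_(s <- drop k w) s)%g.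

Lemma suffix_prod_step w k : (k < size w)%N ->
  suffix_prod w k = (nth 1 w k * suffix_prod w k.+1)%g.
Proof. by move=> kw; rewrite /suffix_prod (drop_nth 1%g kw) big_cons. Qed.

Lemma geodesic_drop w k : geodesic w -> geodesic (drop k w).
Proof.
move=> [wS wmin]; have := wS.
rewrite -{1}(cat_take_drop k w) /word_in all_cat => /andP[tS dS].
split=> // w' w'S w'E.
have := wmin (take k w ++ w').
rewrite /word_in all_cat tS => /(_ w'S); rewrite big_cat/= w'E -big_cat.
rewrite cat_take_drop => /(_ erefl).
by rewrite -{1}(cat_take_drop k w) !size_cat leq_add2l.
Qed.

(** The suffix starting at [k] is itself a shortest word, so its value has
    length [size w - k], which determines [k]. *)
Lemma suffix_prod_inj w : geodesic w ->
  {in [pred k | (k <= size w)%N] &, injective (suffix_prod w)}.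
Proof.
move=> gw j k; rewrite !inE => jw kw jk.
have [jS jmin] := geodesic_drop j gw; have [kS kmin] := geodesic_drop k gw.
have := jmin _ kS (esym jk); have := kmin _ jS jk.
rewrite !size_drop => jk1 kj1.
have /eqP : (size w - j = size w - k)%N by apply/eqP; rewrite eqn_leq jk1 kj1.
by rewrite eqn_sub2lE// => /eqP.
Qed.

Lemma word_length_geodesic (genS : generates S) g :
  exists w, [/\ geodesic w, size w = word_length genS g &
                (\prod_(s <- w) s)%g = g].
Proof.
rewrite /word_length; case: ex_minnP => n /asboolP[w [wS wn wg]] nmin.
exists w; split=> //; split=> // w' w'S w'E; rewrite wn; apply: nmin.
by apply/asboolP; exists w'; rewrite w'E wg.
Qed.

End geodesic.

Section increments.
Variables (R : realType) (T : groupType) (p : R) (F : T -> R) (S : seq T).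

(** The constant is the sum of the p-th powers of the l^p norms of L_s F - F
    for s a generator or the inverse of one: a geodesic visits each point at
    most once, so each of these functions is summed over distinct points. *)
Lemma geodesic_increments : (forall g, in_lp p (left_act g F \- F)) ->
  exists M : R,
  forall w, geodesic S w ->
    \sum_(0 <= k < size w)
      `|F (suffix_prod w k.+1) - F (suffix_prod w k)| `^ p <= M.
Proof.
move=> Fp; pose S' := S ++ [seq s^-1%g | s <- S].
exists (\sum_(s <- S')
  fine (\esum_(x in [set: T]) (`|(left_act s F \- F) x| `^ p)%:E)).
move=> w gw.
have nthS' k : (k < size w)%N -> (nth 1%g w k)^-1%g \in S'.
  move=> kw; have /allP/(_ _ (mem_nth 1%g kw)) := gw.1.
  rewrite mem_cat => /orP[sS|->//].
  by rewrite (map_f (fun s => s^-1%g) sS) orbT.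
pose xs := [seq suffix_prod w k.+1 | k <- index_iota 0 (size w)].
have uxs : uniq xs.
  rewrite map_inj_in_uniq ?iota_uniq// => j k.
  rewrite !mem_index_iota/= => jw kw jk.
  by apply: succn_inj; apply: (suffix_prod_inj gw).
apply: (@le_trans _ _ (\sum_(s <- S') \sum_(x <- xs)
    `|(left_act s F \- F) x| `^ p)); last first.
  by apply: ler_sum => s _; exact: in_lp_sum.
rewrite exchange_big/= big_map; apply: ler_sum_nat => k /andP[_ kw].
rewrite (big_rem _ (nthS' k kw))/= /left_act invgK -suffix_prod_step//.
by rewrite distrC lerDl sumr_ge0// => s _; exact: powR_ge0.
Qed.

End increments.

Theorem lp_growth (R : realType) (T : groupType) (p p' : R) (F : T -> R) :
  1 < p -> p^-1 + p'^-1 = 1 ->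
  (forall g, in_lp p (left_act g F \- F)) ->
  forall (S : seq T) (genS : generates S),
  exists c : R, forall g, g != 1%g ->
    `|F g| <= c * (word_length genS g)%:R `^ p'^-1.
Proof.
move=> p1 pp' Fp S genS.
have [M FM] := geodesic_increments S Fp.
exists (`|F 1%g| + 1 + M) => g g1.
have [w [gw wn wg]] := word_length_geodesic genS g.
have w0 : (0 < size w)%N.
  by case: w wg {gw wn} => //= /esym; rewrite big_nil => /eqP; rewrite (negPf g1).
have q0 : 0 <= p'^-1.
  have -> : p'^-1 = 1 - p^-1 by rewrite -pp' addrAC subrr add0r.
  by rewrite subr_ge0 invf_le1 ?(lt_trans _ p1)// ltW.
have n1 : 1 <= (size w)%:R `^ p'^-1 :> R.
  by rewrite -[leLHS](powRr0 (size w)%:R) ler_powR// ler1n.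
have Fg : F g = F 1%g - \sum_(0 <= k < size w)
    (F (suffix_prod w k.+1) - F (suffix_prod w k)).
  rewrite (telescope_sumr (fun k => F (suffix_prod w k)))//.
  by rewrite /suffix_prod drop_size drop0 wg big_nil subKr.
rewrite -wn Fg (le_trans (ler_normB _ _))// -addrA mulrDl lerD//.
  by rewrite ler_peMr.
apply: le_trans (ler_norm_sum _ _ _) _.
rewrite (le_trans (sum_le_powR p1 pp' w0 _))// mulrC.
by rewrite ler_wpM2r ?powR_ge0// lerD2l FM.
Qed.

Unset Implicit Arguments.
Set Strict Implicit.

Theorem theorem5p1 (R : realType) (G : groupClosed (SO21 R)) (p p' : R)
    (F : subgroup_type G -> R) :
  cocompact_lattice G ->
  1 < p -> p^-1 + p'^-1 = 1 ->
  (forall g : subgroup_type G, in_lp p (left_act g F \- F)) ->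
  forall (S : seq (subgroup_type G)) (genS : generates S),
  exists c : R, forall g : subgroup_type G, g != 1%g ->
    `|F g| <= c * (word_length genS g)%:R `^ p'^-1.
Proof. by move=> _; exact: lp_growth. Qed.
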